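(* For every concept class $\mathcal C\subseteq\{0,1\}^N$ with $|\mathcal C|\ge2$, $$\mathrm{fETD}(\mathcal C)\ \le\ \frac{1}{\mathrm f\gamma(\mathcal C)}\ \le\ 2\,\mathrm{fETD}(\mathcal C).$$
   Context: A concept class is a set $\mathcal C\subseteq\{0,1\}^N$. For $i\in[N]$ and $b\in\{0,1\}$ put $\mathcal C_{i,b}=\{c\in\mathcal C: c_i=b\}$. The fractional splitting parameter is $$\mathrm f\gamma(\mathcal C)=\min_{\mu}\ \max_{i\in[N]}\ \min\{\mu(\mathcal C_{i,0}),\mu(\mathcal C_{i,1})\},$$ the minimum being over probability distributions $\mu$ on $\mathcal C$ with $\max_{c\in\mathcal C}\mu(c)\le 1/2$. For $h\in\{0,1\}^N$, $$\mathrm{fETD}(\mathcal C,h)=\min_{c^*\in\mathcal C,\ w_1,\dots,w_N\ge0}\Big\{\sum_{i=1}^N w_i:\ \sum_{i:c_i\ne h_i}w_i\ge1\ \text{for every } c\in\mathcal C\setminus\{c^*\}\Big\},$$ with $w_1,\dots,w_N$ real, and the fractional extended teaching dimension is $\mathrm{fETD}(\mathcal C)=\max_{h\in\{0,1\}^N}\mathrm{fETD}(\mathcal C,h)$. *)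

(* Defs.v *)
From HB Require Import structures.
From mathcomp Require Import all_boot all_order all_algebra.
From mathcomp Require Import all_classical all_reals.

Set Implicit Arguments.
Unset Strict Implicit.
Unset Printing Implicit Defensive.

Import Order.TTheory GRing.Theory Num.Theory.
Local Open Scope classical_set_scope.
Local Open Scope ring_scope.

Definition concept (N : nat) : Type := {ffun 'I_N -> bool}.

Definition concept_class (N : nat) : Type := {set {ffun 'I_N -> bool}}.

Definition restrict (N : nat) (C : concept_class N) (i : 'I_N) (b : bool) :
    concept_class N :=
  [set c in C | c i == b]%SET.

Definition mass (R : realType) (N : nat) (mu : concept N -> R)
    (A : concept_class N) : R :=
  \sum_(c in A) mu c.

Definition is_distribution (R : realType) (N : nat) (C : concept_class N)
    (mu : concept N -> R) : Prop :=
  [/\ forall c, 0 <= mu c,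
      forall c, c \notin C -> mu c = 0
    & mass mu C = 1].

(* The iterated maxima below start from 0, which is harmless because all the
   terms are nonnegative (for [split_value], when [mu] is a distribution).  The
   minima over real-valued parameters are infima: when C has at least two
   elements the sets involved are nonempty and attain their infimum, by
   compactness. *)

Definition split_value (R : realType) (N : nat) (C : concept_class N)
    (mu : concept N -> R) : R :=
  \big[Num.max/0]_(i < N)
    Num.min (mass mu (restrict C i false)) (mass mu (restrict C i true)).

Definition fgamma (R : realType) (N : nat) (C : concept_class N) : R :=
  inf [set split_value C mu | mu in
        [set mu : concept N -> R |
          is_distribution C mu /\ forall c, c \in C -> mu c <= 1 / 2]].

Definition fractional_teaching (R : realType) (N : nat) (C : concept_class N)
    (h cstar : concept N) (w : 'I_N -> R) : Prop :=
  (forall i, 0 <= w i) /\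
  (forall c, c \in C -> c != cstar -> 1 <= \sum_(i < N | c i != h i) w i).

Definition fETD_at (R : realType) (N : nat) (C : concept_class N)
    (h : concept N) : R :=
  inf [set s : R | exists (cstar : concept N) (w : 'I_N -> R),
        [/\ cstar \in C, fractional_teaching C h cstar w
          & s = \sum_(i < N) w i]].

Definition fETD (R : realType) (N : nat) (C : concept_class N) : R :=
  \big[Num.max/0]_(h : {ffun 'I_N -> bool}) fETD_at R C h.

(* Main.v *)
(** Upper bound on 1 / fgamma: given mu, let h be the coordinatewise majority
    vote of mu.  Averaging the teaching constraints for h against mu, which
    leaves mass at least 1/2 outside the exempted concept, gives
    1/2 <= split_value mu * \sum_i w i.

    Upper bound on fETD: fix h with T := fETD_at h > 0.  For any weights p on
    the coordinates, let c1, c2 be the two concepts with the smallest p-weight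
    of disagreement with h.  Normalising p by the weight of c2 and exempting c1
    is a feasible teaching strategy, so the weight of c2 is at most
    (\sum_i p i) / T; the uniform measure on {c1, c2} therefore has p-average
    disagreement at most 1 / T.  By the minimax principle some mu with atoms at
    most 1/2 has disagreement at most 1 / T + eps at every coordinate, whence
    fgamma <= 1 / T.  The minimax principle is used in an approximate form that
    needs neither compactness nor linear programming: Blackwell's approachability
    of the negative orthant. *)
Require Import Defs.
From HB Require Import structures.
From mathcomp Require Import all_boot all_order all_algebra.
From mathcomp Require Import all_classical all_reals.
From mathcomp Require Import ring lra.

Import Order.TTheory GRing.Theory Num.Theory.
Local Open Scope ring_scope.

(** * Approachability of the negative orthant *)

Lemma sqr_max0D_le (R : realDomainType) (a b x : R) : 0 <= a ->
  Num.max 0 (a * x + b) ^+ 2 <= (a * Num.max 0 x + b) ^+ 2.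
Proof.
move=> a0.
have [h|h] := leP (a * x + b) 0; first by rewrite expr0n sqr_ge0.
have ax : a * x <= a * Num.max 0 x by rewrite ler_wpM2l // le_max lexx orbT.
by rewrite ler_pXn2r ?nnegrE //; lra.
Qed.

(* Steering each new point against the positive part of the running average
   makes the squared distance of the average to the orthant decay like 1/n. *)
Lemma negative_orthant_approachable (R : archiRealFieldType) (I : finType)
    (S : (I -> R) -> Prop) (B : R) :
  (forall x y t, S x -> S y -> 0 <= t <= 1 ->
     S (fun i => (1 - t) * x i + t * y i)) ->
  (forall x, S x -> \sum_i x i ^+ 2 <= B) ->
  (forall p : I -> R, (forall i, 0 <= p i) ->
     exists2 x, S x & \sum_i p i * x i <= 0) ->
  forall e, 0 < e -> exists2 x, S x & forall i, x i <= e.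
Proof.
move=> Sconv SB Shalf e e0.
have decay n : exists2 x, S x &
    n.+1%:R * (\sum_i Num.max 0 (x i) ^+ 2) <= B.
  elim: n => [|n [x Sx IH]].
    have [x Sx _] := Shalf (fun=> 0) (fun=> lexx 0).
    exists x => //; rewrite mul1r; apply: le_trans (SB _ Sx).
    apply: ler_sum => i _.
    by have := sqr_max0D_le _ 0 (x i) 0 (lexx 0); rewrite !mul0r !add0r.
  (* With the positive part of [x] as weights, the cross term of the expanded square is
     nonpositive. *)
  have [d Sd dle] := Shalf (fun i => Num.max 0 (x i))
    (fun i => ltac:(by rewrite le_max lexx)).
  pose m : R := n.+1%:R.
  have m0 : 0 < m by rewrite ltr0n.
  have mS : n.+2%:R = m + 1 by rewrite -natr1.
  have m1 : 0 < m + 1 by lra.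
  (* [x] plays the average of [m] points, so the new point gets weight [1 / (m + 1)]. *)
  exists (fun i => (1 - (m + 1)^-1) * x i + (m + 1)^-1 * d i).
    apply: Sconv => //; rewrite invr_ge0 ltW //= invf_le1 //; lra.
  rewrite mS -(ler_pM2l m1) mulrA -expr2 mulr_sumr.
  apply: (@le_trans _ _ (\sum_i (m ^+ 2 * Num.max 0 (x i) ^+ 2
      + 2 * m * (Num.max 0 (x i) * d i) + d i ^+ 2))).
    apply: ler_sum => i _.
    have -> : (1 - (m + 1)^-1) * x i + (m + 1)^-1 * d i
        = (m + 1)^-1 * (m * x i + d i) by field; lra.
    have s0 : 0 <= (m + 1)^-1 by rewrite invr_ge0 ltW.
    have -> : Num.max 0 ((m + 1)^-1 * (m * x i + d i))
        = (m + 1)^-1 * Num.max 0 (m * x i + d i) by rewrite maxr_pMr // mulr0.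
    rewrite -exprMn mulVKf ?lt0r_neq0 //.
    apply: le_trans (sqr_max0D_le _ m (d i) (x i) (ltW m0)) _.
    by rewrite le_eqVlt; apply/orP; left; apply/eqP; ring.
  rewrite !big_split /= -!mulr_sumr.
  have := SB _ Sd.
  have : 2 * m * (\sum_i Num.max 0 (x i) * d i) <= 0.
    by rewrite pmulr_rle0 // mulr_gt0.
  have : m ^+ 2 * (\sum_i Num.max 0 (x i) ^+ 2) <= m * B.
    by rewrite expr2 -mulrA ler_pM2l.
  lra.
(* After more than [B / e ^+ 2] rounds, a single coordinate above [e] would push the scaled sum past
   [B]. *)
have [x Sx xB] := decay (Num.truncn (B / e ^+ 2)).
exists x => // i; rewrite leNgt; apply/negP => lt_e.
have /ltW := truncnS_gt (B / e ^+ 2).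
set n := (Num.truncn _).+1%:R in xB *.
rewrite ler_pdivrMr ?exprn_gt0 // => Bn.
have n0 : 0 < n by rewrite ltr0n.
have := le_trans xB Bn; rewrite ler_pM2l // leNgt => /negP; apply.
rewrite (bigD1 i) //= ltr_wpDr ?sumr_ge0 // => [j _|]; first exact: sqr_ge0.
have -> : Num.max 0 (x i) = x i by apply/max_idPr; lra.
by rewrite ltr_pXn2r ?nnegrE //; lra.
Qed.

(** * Masses, disagreement weights and the two infima *)

Section ConceptClass.
Variables (R : realType) (N : nat) (C : concept_class N).
Implicit Types (mu : concept N -> R) (h c : concept N) (w p : 'I_N -> R).

Definition half_bounded mu :=
  is_distribution C mu /\ forall c, c \in C -> mu c <= 1 / 2.

Definition disagreement h w c : R := \sum_(i < N | c i != h i) w i.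

Lemma disagreement_ge0 h w c : (forall i, 0 <= w i) -> 0 <= disagreement h w c.
Proof. by move=> w0; apply: sumr_ge0. Qed.

Lemma mass_restrict mu i b :
  mass mu (Defs.restrict C i b) = \sum_(c in C | c i == b) mu c.
Proof. by apply: eq_bigl => c; rewrite inE. Qed.

Lemma mass_restrict_ge0 mu i b :
  is_distribution C mu -> 0 <= mass mu (Defs.restrict C i b).
Proof. by case=> mu0 _ _; apply: sumr_ge0. Qed.

Lemma mass_restrictD mu i b : is_distribution C mu ->
  mass mu (Defs.restrict C i b) + mass mu (Defs.restrict C i (~~ b)) = 1.
Proof.
case=> _ _ <-; rewrite !mass_restrict [RHS](bigID (fun c => c i == b)) /=.
by congr (_ + _); apply: eq_bigl => c; case: (c i); case: b.
Qed.

(** Double counting: [mu c * w i] occurs on either side exactly when [c] differs from [h] at [i]. *)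
Lemma sum_mass_restrict mu h w :
  \sum_i w i * mass mu (Defs.restrict C i (~~ h i))
    = \sum_(c in C) mu c * disagreement h w c.
Proof.
under eq_bigr do rewrite mass_restrict mulr_sumr big_mkcondr.
rewrite exchange_big; apply: eq_bigr => c _.
rewrite mulr_sumr [RHS]big_mkcond; apply: eq_bigr => i _.
by case: (c i); case: (h i); rewrite //= mulrC.
Qed.

Lemma split_value_ge0 mu : 0 <= split_value C mu.
Proof. rewrite /split_value; elim/big_rec: _ => // i x _ x0.
by rewrite le_max x0 orbT. Qed.

Lemma min_le_split_value mu i :
  Num.min (mass mu (Defs.restrict C i false)) (mass mu (Defs.restrict C i true))
    <= split_value C mu.
Proof. exact: le_bigmax. Qed.

Lemma fgamma_le mu : half_bounded mu -> fgamma R C <= split_value C mu.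
Proof.
move=> hmu; apply: ge_inf; last by exists mu.
by exists 0 => _ [nu _ <-]; apply: split_value_ge0.
Qed.

Lemma split_value_le mu h v : 0 <= v ->
  (forall i, mass mu (Defs.restrict C i (~~ h i)) <= v) -> split_value C mu <= v.
Proof.
move=> v0 hv; apply/bigmax_leP; split=> // i _; rewrite ge_min.
by have := hv i; case: (h i) => /= ->; rewrite ?orbT.
Qed.

Lemma fETD_at_le h c w : c \in C -> fractional_teaching C h c w ->
  fETD_at R C h <= \sum_i w i.
Proof.
move=> cC hw; apply: ge_inf; last by exists c, w.
by exists 0 => _ [c' [w' [_ [w0 _] ->]]]; apply: sumr_ge0.
Qed.

Lemma fractional_teaching_exists h : (0 < #|C|)%N ->
  exists c w, c \in C /\ fractional_teaching C h c w.
Proof.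
move=> /card_gt0P[c0 c0C].
(* Unit weights work: any concept other than [h] differs from it somewhere, and [h] is exempted if
   it lies in [C]. *)
exists (if h \in C then h else c0), (fun=> 1); split; first by case: ifP.
split=> // c cC cneq.
have [i ci|ch] := pickP (fun i => c i != h i).
  by rewrite (bigD1 i) //= lerDl sumr_ge0.
have ech : c = h by apply/ffunP => i; have /negbFE/eqP := ch i.
by move: cneq; rewrite -ech cC eqxx.
Qed.

Lemma le_fETD_at h v : (0 < #|C|)%N ->
  (forall c w, c \in C -> fractional_teaching C h c w -> v <= \sum_i w i) ->
  v <= fETD_at R C h.
Proof.
move=> /(fractional_teaching_exists h)[c [w [cC hw]]] hv; apply: lb_le_inf.
  by exists (\sum_i w i), c, w.
by move=> _ [c' [w' [c'C hw' ->]]]; apply: hv hw'.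
Qed.

Lemma fETD_at_le_fETD h : fETD_at R C h <= fETD R C.
Proof. exact: le_bigmax. Qed.

(** The uniform measure on the pair when [c1 != c2]; its atoms then have the largest mass
    allowed. *)
Definition pair_measure (c1 c2 : concept N) : concept N -> R :=
  fun c => ((c == c1)%:R + (c == c2)%:R) / 2.

Lemma sum_pair_measure c1 c2 (f : concept N -> R) : c1 \in C -> c2 \in C ->
  \sum_(c in C) pair_measure c1 c2 c * f c = (f c1 + f c2) / 2.
Proof.
move=> c1C c2C.
have pick c0 : c0 \in C -> \sum_(c in C) (c == c0)%:R * f c = f c0.
  move=> c0C; rewrite (bigD1 c0) //= eqxx mul1r big1 ?addr0 // => c.
  by case/andP=> _ /negPf->; rewrite mul0r.
rewrite -(pick c1) // -(pick c2) // -big_split mulr_suml /=.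
by apply: eq_bigr => c _; rewrite /pair_measure; ring.
Qed.

Lemma pair_measure_half_bounded c1 c2 : c1 \in C -> c2 \in C -> c1 != c2 ->
  half_bounded (pair_measure c1 c2).
Proof.
move=> c1C c2C c12; split; first split.
- by move=> c; rewrite /pair_measure divr_ge0 // addr_ge0.
- move=> c cC; rewrite /pair_measure.
  have -> : (c == c1) = false by apply: contraNF cC => /eqP ->.
  have -> : (c == c2) = false by apply: contraNF cC => /eqP ->.
  by rewrite addr0 mul0r.
- rewrite /mass -[RHS](_ : (1 + 1) / 2 = 1 :> R); last by field.
  rewrite -(sum_pair_measure c1 c2 (fun=> 1)) //.
  by apply: eq_bigr => c _; rewrite mulr1.
- move=> c _; rewrite /pair_measure ler_pM2r ?invr_gt0 //.
  have [->|_] := eqVneq c c1; first by rewrite (negPf c12) addr0.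
  by rewrite add0r; case: eqP.
Qed.

Lemma half_bounded_convex mu nu t : half_bounded mu -> half_bounded nu ->
  0 <= t <= 1 -> half_bounded (fun c => (1 - t) * mu c + t * nu c).
Proof.
move=> [[mu0 muC mu1] mu2] [[nu0 nuC nu1] nu2] /andP[t0 t1].
have t1' : 0 <= 1 - t by lra.
split; first split.
- by move=> c; rewrite addr_ge0 // mulr_ge0.
- by move=> c cC; rewrite muC // nuC // !mulr0 addr0.
- move: mu1 nu1; rewrite /mass big_split /= -!mulr_sumr => -> ->.
  by rewrite !mulr1 subrK.
- move=> c cC.
  have := ler_wpM2l t1' (mu2 c cC); have := ler_wpM2l t0 (nu2 c cC).
  lra.
Qed.

Lemma half_bounded_exists : (2 <= #|C|)%N -> exists mu, half_bounded mu.
Proof.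
move=> /card_gt1P[c1 [c2 [c1C c2C c12]]].
by exists (pair_measure c1 c2); apply: pair_measure_half_bounded.
Qed.

Lemma le_fgamma v : (2 <= #|C|)%N ->
  (forall mu, half_bounded mu -> v <= split_value C mu) -> v <= fgamma R C.
Proof.
move=> /half_bounded_exists[mu hmu] hv; apply: lb_le_inf.
  by exists (split_value C mu), mu.
by move=> _ [nu hnu <-]; apply: hv.
Qed.

(** * Teaching weights against splitting measures *)

Lemma teaching_mul_split_value_ge mu : half_bounded mu -> exists h,
  forall c w, c \in C -> fractional_teaching C h c w ->
    1 / 2 <= split_value C mu * \sum_i w i.
Proof.
move=> [dmu mu2]; have [mu0 muC mu1] := dmu.
(* The majority vote depends on [mu] alone, so the bound passes to the infimum over [c] and [w]. *)
pose h : concept N := [ffun i =>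
  mass mu (Defs.restrict C i false) <= mass mu (Defs.restrict C i true)].
exists h => c w cC [w0 hw].
have minority i : mass mu (Defs.restrict C i (~~ h i)) <= split_value C mu.
  apply: le_trans (min_le_split_value mu i); rewrite le_min /h ffunE.
  set m0 := mass mu (Defs.restrict C i false).
  set m1 := mass mu (Defs.restrict C i true).
  by case: (leP m0 m1) => [|/ltW] le01; rewrite /= lexx ?andbT.
apply: (@le_trans _ _ (\sum_i w i * mass mu (Defs.restrict C i (~~ h i)))); last first.
  by rewrite mulrC mulr_suml; apply: ler_sum => i _; rewrite ler_wpM2l.
rewrite sum_mass_restrict (bigD1 c) //=.
have rest : \sum_(c' in C | c' != c) mu c'
    <= \sum_(c' in C | c' != c) mu c' * disagreement h w c'.
  apply: ler_sum => c' /andP[c'C c'c].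
  by rewrite -{1}[mu c']mulr1 ler_wpM2l // hw.
have := mulr_ge0 (mu0 c) (disagreement_ge0 h w c w0).
move: mu1; rewrite /mass (bigD1 c) //=; have := mu2 c cC.
lra.
Qed.

Lemma two_closest_disagreement_le h p : (2 <= #|C|)%N ->
  0 < fETD_at R C h -> (forall i, 0 <= p i) ->
  exists c1 c2, [/\ c1 \in C, c2 \in C, c1 != c2 &
    disagreement h p c1 <= disagreement h p c2 /\
    disagreement h p c2 <= (\sum_i p i) / fETD_at R C h].
Proof.
move=> /card_gt1P[a [b [aC bC ab]]] T0 p0.
case: (arg_minP (disagreement h p) aC) => c1 c1C min1.
have [d /andP[dC dc1]] : exists d, (d \in C) && (d != c1).
  by have [e|ne] := eqVneq a c1; [exists b; rewrite bC -e eq_sym | exists a; rewrite aC].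
pose P c := (c \in C) && (c != c1).
have Pd : P d by apply/andP.
case: (arg_minP (disagreement h p) Pd) => c2 /andP[c2C c21] min2.
exists c1, c2; split => //; first by rewrite eq_sym.
split; first exact: min1.
set s := disagreement h p c2.
(* Normalising by [s] needs [0 < s]; otherwise the bound is immediate. *)
have [s0|s0] := leP s 0.
  by apply: le_trans s0 _; rewrite divr_ge0 ?sumr_ge0 // ltW.
rewrite ler_pdivlMr // mulrC -ler_pdivlMr // mulr_suml.
apply: (@fETD_at_le h c1) => //; split=> [i|c cC cc1].
  by rewrite divr_ge0 // ltW.
rewrite -mulr_suml ler_pdivlMr // mul1r.
by apply: min2; rewrite /P cC.
Qed.

Lemma fgamma_le_invf h : (2 <= #|C|)%N -> 0 < fETD_at R C h ->
  fgamma R C <= (fETD_at R C h)^-1.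
Proof.
move=> C2 T0; set v := _^-1.
have v0 : 0 < v by rewrite invr_gt0.
apply/ler_addgt0Pr => e e0.
(* [x i] is the excess over [v] of the mass disagreeing with [h] at [i]. *)
pose S x := exists2 mu, half_bounded mu &
  forall i, x i = mass mu (Defs.restrict C i (~~ h i)) - v.
have [|||x [mu hmu xE] xe] :=
    negative_orthant_approachable _ _ S (\sum_(i < N) (1 + v) ^+ 2) _ _ _ _ e0.
- move=> x y t [mu hmu xE] [nu hnu yE] t01.
  exists (fun c => (1 - t) * mu c + t * nu c); first exact: half_bounded_convex.
  by move=> i; rewrite xE yE /mass big_split /= -!mulr_sumr; ring.
(* Masses lie between 0 and 1, so each excess is at most [1 + v] in absolute value. *)
- move=> x [mu [dmu _] xE]; apply: ler_sum => i _; rewrite xE.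
  have := mass_restrictD mu i (h i) dmu.
  have := mass_restrict_ge0 mu i (h i) dmu.
  have := mass_restrict_ge0 mu i (~~ h i) dmu.
  move=> m0 m1 mD; rewrite -ler_sqrt ?sqr_ge0 // !sqrtr_sqr.
  by rewrite ler_norml [`|1 + v|]ger0_norm; lra.
- move=> p p0.
  have [c1 [c2 [c1C c2C c12 [le12 le2]]]] :=
    two_closest_disagreement_le h p C2 T0 p0.
  exists (fun i => mass (pair_measure c1 c2) (Defs.restrict C i (~~ h i)) - v).
    by exists (pair_measure c1 c2) => //; apply: pair_measure_half_bounded.
  under eq_bigr do rewrite mulrBr.
  rewrite sumrB sum_mass_restrict sum_pair_measure // -mulr_suml.
  rewrite -/v in le2; lra.
apply: le_trans (fgamma_le mu hmu) _.
apply: (split_value_le mu h) => [|i]; first lra.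
by have := xe i; rewrite xE; lra.
Qed.

End ConceptClass.

(** * Passage to the infimum over measures and the maximum over [h] *)

Theorem lemma4p9 (R : realType) (N : nat) (C : concept_class N)
    (hC : (2 <= #|C|)%N) :
  fETD R C <= 1 / fgamma R C /\ 1 / fgamma R C <= 2 * fETD R C.
Proof.
have C0 : (0 < #|C|)%N by exact: ltnW.
have halfP mu : half_bounded R N C mu ->
    1 / 2 <= split_value C mu * fETD R C /\ 0 < fETD R C.
  move=> hmu; have [h hh] := teaching_mul_split_value_ge R N C mu hmu.
  (* A zero value would give [1 / 2 <= 0] for any feasible strategy. *)
  have s0 : 0 < split_value C mu.
    rewrite lt0r split_value_ge0 andbT; apply/eqP => s0.
    have [c [w [cC hw]]] := fractional_teaching_exists R N C h C0.
    by have := hh c w cC hw; rewrite s0 mul0r leNgt divr_gt0.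
  have : (1 / 2) / split_value C mu <= fETD_at R C h.
    apply: le_fETD_at => // c w cC /(hh c w cC) le.
    by rewrite ler_pdivrMr // [leRHS]mulrC.
  move=> /le_trans /(_ (fETD_at_le_fETD R N C h)) le.
  split; first by rewrite [leRHS]mulrC -ler_pdivrMr.
  by apply: lt_le_trans le; rewrite !divr_gt0.
have F0 : 0 < fETD R C.
  by have [mu /halfP[]] := half_bounded_exists R N C hC.
have leg : (2 * fETD R C)^-1 <= fgamma R C.
  apply: le_fgamma => // mu /halfP[le _].
  by rewrite -div1r ler_pdivrMr ?mulr_gt0 //; lra.
(* The inverse of 0 is 0 here, so positivity must precede inverting the bounds. *)
have g0 : 0 < fgamma R C.
  by apply: lt_le_trans leg; rewrite invr_gt0 mulr_gt0.
rewrite div1r; split; last first.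
  by rewrite -[leRHS]invrK lef_pV2 // posrE invr_gt0 mulr_gt0.
apply/bigmax_leP; split=> [|h _]; first by rewrite invr_ge0 ltW.
have [T0|T0] := leP (fETD_at R C h) 0.
  by apply: le_trans T0 _; rewrite invr_ge0 ltW.
rewrite -[leLHS]invrK lef_pV2 ?posrE ?invr_gt0 //.
exact: fgamma_le_invf.
Qed.
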